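(* Suppose $q>0$. Let $\tilde H\in\mathbb{R}^{\mathcal I_N\times\mathcal I_N}$ be strictly lower triangular and let $\tau>0$. Let $\Lambda\in\mathbb{R}^{N\times N}$ be invertible and define $$\Phi=(\bar P\Lambda\bar P)^{-1},\qquad \mathcal R=\begin{bmatrix}-\Lambda_W\bar P_W&0&0\\0&0&1\\0&1&0\end{bmatrix}.$$ Then $$\mathcal L^{\mathrm{G,D}}_{\Lambda_W,\tilde H}=\mathcal R\,\mathcal L^{\mathrm{G,D}}_{\Phi_W,\tilde H^A}\,\mathcal R^\intercal,$$ and $\Lambda_W$ is an unsigned certificate for (G,D) convergence of $\tilde H$ with rate $\tau$ if and only if $\Phi_W$ is an unsigned certificate for (G,D) convergence of $\tilde H^A$ with rate $\tau$. Moreover, if $\Lambda$ is symmetric then $\Phi$ is also symmetric.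
   Context: $N\ge1$ is an integer, $\mathcal I_N=\{0,\dots,N\}$ indexes rows/columns, $e_0,\dots,e_N$ is the standard basis, $\mathbb{1}$ the all-ones vector. $S\in\mathbb{R}^{\mathcal I_N\times\mathcal I_N}$ has ones on and below the diagonal and zeros elsewhere, $R$ is the reversal permutation matrix, $P=SR$; $\bar S,\bar R,\bar P=\bar S\bar R$ are the $N\times N$ analogues. The antitranspose is $X^A=RX^\intercal R$, and $\mathrm{sym}(X)=\frac12(X+X^\intercal)$. Let $W=\begin{bmatrix}\bar R\\0^\intercal\end{bmatrix}$ (a map $\mathbb{R}^N\to\mathbb{R}^{\mathcal I_N}$), and for $\Gamma\in\mathbb{R}^{N\times N}$ let $\Gamma_W=W\Gamma W^\intercal$; in particular $\bar P_W=W\bar PW^\intercal$. For strictly lower triangular $\tilde H$ put $H=(S^{-1}+\tilde H)((1+q)I+qS\tilde H)^{-1}$, $v_H=(I-qSH)\mathbb{1}$, $\eta_H=e_N^\intercal v_H$. For $\tau>0$ and $\Gamma\in\mathbb{R}^{\mathcal I_N\times\mathcal I_N}$ the lifted slack matrix for (G,D) is the symmetric block matrix $$\mathcal L^{\mathrm{G,D}}_{\Gamma,\tilde H}=\begin{bmatrix}-2\,\mathrm{sym}(\Gamma A)&\Gamma b&w\\ \cdot&\tau&\zeta\\ \cdot&\cdot&\tau\end{bmatrix},$$ with $A=SH+\frac1qv_He_0^\intercal$, $b=\frac{1+q}qv_H$, $w=(I-(1+q)SH)^\intercal e_N-\frac{1+q}q\eta_He_0$, $\zeta=\frac{(1+q)^2}q\eta_H$.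 For $\mathcal L_{\Phi_W,\tilde H^A}$ the matrix $H$ is the one built from $\tilde H^A$. Unsigned certificates: elements of $\mathbb{R}^d$ are row vectors. Given $y_0\in\mathbb{R}^d$, $\mathbf g\in\mathbb{R}^{\mathcal I_N\times d}$, let $\mathbf x=-SH\mathbf g+v_Hy_0$, $\mathbf s=\mathbf g+q\mathbf x$, $\mathbf y=\mathbf x+\mathbf s$, with rows $x_i,s_i,y_i$ (row $0$ of $\mathbf y$ is $y_0$). $\Gamma\in\mathbb{R}^{\mathcal I_N\times\mathcal I_N}$ is an unsigned certificate for (G,D) convergence of $\tilde H$ with rate $\tau$ if $\frac\tau2\|s_0\|^2-\frac1{2\tau}\|y_N\|^2+\mathrm{tr}(\mathbf g^\intercal\Gamma\mathbf x)\ge0$ for all $(y_0,\mathbf g)$; in the operator setting ($\frac{1-\mu}{1+\mu}$-contractive operators, $q=\mu/(1-\mu)$), as opposed to the function setting ($1$-smooth $\mu$-strongly convex functions), $\Gamma$ is additionally required to be symmetric. The claim holds in both settings. *)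

(* Defs.v *)
From HB Require Import structures.
From mathcomp Require Import all_boot all_order all_algebra.
From mathcomp Require Import reals.

Set Implicit Arguments.
Unset Strict Implicit.
Unset Printing Implicit Defensive.

Import Order.TTheory GRing.Theory Num.Theory.
Local Open Scope ring_scope.

(* The index set {0, ..., N} is 'I_N.+1, with e_0 and e_N the unit columns at
   ord0 and ord_max. The matrices S, R and P take their size n as an argument:
   n = N.+1 gives the unbarred ones, n = N the barred ones. *)

Section Matrices.
Variable K : realType.

Definition Smx (n : nat) : 'M[K]_n := \matrix_(i, j) (j <= i)%:R.

Definition Rmx (n : nat) : 'M[K]_n := \matrix_(i, j) (i == rev_ord j)%:R.

Definition Pmx (n : nat) : 'M[K]_n := Smx n *m Rmx n.

Definition antitr (n : nat) (X : 'M[K]_n) : 'M[K]_n := Rmx n *m X^T *m Rmx n.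

Definition sym (n : nat) (X : 'M[K]_n) : 'M[K]_n := 2^-1 *: (X + X^T).

Definition symmetric_mx (n : nat) (X : 'M[K]_n) : Prop := X^T = X.

Definition strictly_lower (n : nat) (X : 'M[K]_n) : Prop :=
  forall i j : 'I_n, (i <= j)%N -> X i j = 0.

Definition ones (n : nat) : 'cV[K]_n := const_mx 1.

Definition unit_col (n : nat) (i : 'I_n) : 'cV[K]_n := delta_mx i 0.

(* The cast only identifies N + 1 with N.+1. *)
Definition Wmx (N : nat) : 'M[K]_(N.+1, N) :=
  castmx (addn1 N, erefl N) (col_mx (Rmx N) (0 : 'rV[K]_N)).

Definition liftW (N : nat) (G : 'M[K]_N) : 'M[K]_N.+1 :=
  Wmx N *m G *m (Wmx N)^T.

(* Both inverses are genuine for q > 0 and strictly lower triangular Ht: the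
   matrices inverted are lower triangular with constant diagonals 1 and 1 + q. *)
Definition Hmx (N : nat) (q : K) (Ht : 'M[K]_N.+1) : 'M[K]_N.+1 :=
  (invmx (Smx N.+1) + Ht) *m
  invmx ((1 + q)%:M + q *: (Smx N.+1 *m Ht)).

Definition SHmx (N : nat) (q : K) (Ht : 'M[K]_N.+1) : 'M[K]_N.+1 :=
  Smx N.+1 *m Hmx q Ht.

Definition vH (N : nat) (q : K) (Ht : 'M[K]_N.+1) : 'cV[K]_N.+1 :=
  (1%:M - q *: SHmx q Ht) *m ones N.+1.

Definition etaH (N : nat) (q : K) (Ht : 'M[K]_N.+1) : K :=
  ((unit_col ord_max)^T *m vH q Ht) 0 0.

Definition slackA (N : nat) (q : K) (Ht : 'M[K]_N.+1) : 'M[K]_N.+1 :=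
  SHmx q Ht + q^-1 *: (vH q Ht *m (unit_col ord0)^T).

Definition slackb (N : nat) (q : K) (Ht : 'M[K]_N.+1) : 'cV[K]_N.+1 :=
  ((1 + q) / q) *: vH q Ht.

Definition slackw (N : nat) (q : K) (Ht : 'M[K]_N.+1) : 'cV[K]_N.+1 :=
  (1%:M - (1 + q) *: SHmx q Ht)^T *m unit_col ord_max
  - ((1 + q) / q * etaH q Ht) *: unit_col ord0.

Definition slackzeta (N : nat) (q : K) (Ht : 'M[K]_N.+1) : K :=
  (1 + q) ^+ 2 / q * etaH q Ht.

Definition lifted_slack (N : nat) (q tau : K) (G Ht : 'M[K]_N.+1) :
    'M[K]_(N.+1 + (1 + 1)) :=
  let Gb := G *m slackb q Ht in
  let w := slackw q Ht in
  let zeta := slackzeta q Ht in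
  block_mx (- 2 *: sym (G *m slackA q Ht)) (row_mx Gb w)
           (col_mx Gb^T w^T) (block_mx tau%:M zeta%:M zeta%:M tau%:M).

Definition reversal_congruence (N : nat) (L : 'M[K]_N) :
    'M[K]_(N.+1 + (1 + 1)) :=
  block_mx (- (liftW L *m liftW (Pmx N))) 0
           0 (block_mx 0 1%:M 1%:M 0).

(* Squared Euclidean norm; the library norm on matrices is the sup norm. *)
Definition sqnorm (d : nat) (x : 'rV[K]_d) : K := \sum_(j < d) x 0 j ^+ 2.

Section Trajectory.
Variables (N d : nat) (q : K) (Ht : 'M[K]_N.+1).
Variables (y0 : 'rV[K]_d) (g : 'M[K]_(N.+1, d)).

Definition traj_x : 'M[K]_(N.+1, d) := - (SHmx q Ht *m g) + vH q Ht *m y0.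
Definition traj_s : 'M[K]_(N.+1, d) := g + q *: traj_x.
Definition traj_y : 'M[K]_(N.+1, d) := traj_x + traj_s.

End Trajectory.

End Matrices.

(* Function_setting: 1-smooth mu-strongly convex functions.
   Operator_setting: ((1 - mu) / (1 + mu))-contractive operators.
   In both, q = mu / (1 - mu). *)
Inductive setting := Function_setting | Operator_setting.

Definition unsigned_certificate (K : realType) (N d : nat) (st : setting)
    (q tau : K) (G Ht : 'M[K]_N.+1) : Prop :=
  (st = Operator_setting -> symmetric_mx G) /\
  forall (y0 : 'rV[K]_d) (g : 'M[K]_(N.+1, d)),
    0 <= tau / 2 * sqnorm (row ord0 (traj_s q Ht y0 g))
         - (2 * tau)^-1 * sqnorm (row ord_max (traj_y q Ht y0 g))
         + \tr (g^T *m G *m traj_x q Ht y0 g).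

(* Main.v *)
Require Import Defs.
From mathcomp Require Import all_boot all_order all_algebra.
From mathcomp Require Import reals.
From mathcomp Require Import ring zify.
Import Order.TTheory GRing.Theory Num.Theory.
Local Open Scope ring_scope.

(** Write B = ((1 + q) I + q S Ht)^-1. Everything in the lifted slack matrix is
    affine in B: S H = (I - B) / q, so v_H = B 1 and eta_H = e_N^T B 1. Since S
    is its own antitranspose, replacing Ht by its antitranspose replaces B by
    P B^T P^-1 (resolvent_antitr): up to conjugation by P, reversing the
    algorithm transposes the resolvent.

    The change of basis P exchanges the distinguished vectors, P e_N = 1 and
    P e_0 = e_N, hence eta_H does not change, and A, b, w of the reversed
    algorithm can be expressed through those of the original one. The truncation
    W enters through the single identity W^T P = 1 1^T - Pbar W^T
    (tr_Wmx_Pmx), which trades P for Pbar up to a rank-one term; these rank-one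
    terms are exactly what v_H e_0^T and eta_H e_0 compensate. The outcome is
      W^T A' W Pbar = Pbar W^T A^T W   and   W^T b' = - Pbar W^T w
    (slackA_antitr, slackb_antitr), primes denoting the reversed algorithm.
    Because Ht is strictly lower triangular, e_N is an eigenvector of B, so that
    A^T W and w have no component along e_N and W W^T acts on them as the
    identity. As Lambda Pbar Phi Pbar = I, the congruence of the slack matrices
    then follows block by block: the quadratic block is transposed, and the
    swap of the last two coordinates exchanges the roles of b and w.

    For certificates, s_0 can replace y_0 as a free variable: x = b s_0 - A g
    and y_N = w^T g + zeta s_0. The term - |y_N|^2 / (2 tau) is the minimum over
    u of tau |u|^2 / 2 + <u, y_N>, so completing the square
    (lifted_slack_square) shows that the certificate inequality for all
    (y_0, g) says exactly that the lifted slack matrix is nonnegative on all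
    (g, s_0, u). Congruence transports nonnegativity in one direction. The other
    direction is the same statement applied to Phi and the antitranspose of Ht,
    because both antitranspose and Lambda |-> (Pbar Lambda Pbar)^-1 are
    involutions. *)

(** * Reversal, partial sums and truncation *)

Section Structured.
Local Set Implicit Arguments.
Local Unset Strict Implicit.
Variables (K : realType).
Implicit Types (n N : nat).

Lemma tr_mx11 (X : 'M[K]_1) : X^T = X.
Proof. by apply/matrixP=> i j; rewrite mxE !ord1. Qed.

Lemma mul_Rmx n m (X : 'M[K]_(n, m)) i j : (Rmx K n *m X) i j = X (rev_ord i) j.
Proof.
rewrite mxE (bigD1 (rev_ord i)) //= big1 => [|k ne_k]; rewrite !mxE.
  by rewrite rev_ordK eqxx mul1r addr0.
by rewrite -(inj_eq rev_ord_inj) rev_ordK eq_sym (negPf ne_k) mul0r.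
Qed.

Lemma tr_Rmx n : (Rmx K n)^T = Rmx K n.
Proof.
apply/matrixP=> i j; rewrite !mxE; congr (nat_of_bool _)%:R.
by rewrite -(inj_eq rev_ord_inj) rev_ordK eq_sym.
Qed.

Lemma mulmx_Rmx n m (X : 'M[K]_(m, n)) i j : (X *m Rmx K n) i j = X i (rev_ord j).
Proof. by rewrite -[X *m _]trmxK mxE trmx_mul tr_Rmx mul_Rmx mxE. Qed.

Lemma Rmx_involutive n : Rmx K n *m Rmx K n = 1%:M.
Proof. by apply/matrixP=> i j; rewrite mul_Rmx !mxE (inj_eq rev_ord_inj). Qed.

Lemma Smx_unit n : Smx K n \in unitmx.
Proof.
rewrite unitmxE det_trig; last first.
  by apply/is_trig_mxP=> i j ltij; rewrite mxE leqNgt ltij.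
by rewrite big1 ?unitr1 // => i _; rewrite mxE leqnn.
Qed.

Lemma PmxE n (i j : 'I_n) : Pmx K n i j = (n <= (i + j).+1)%N%:R.
Proof. rewrite mulmx_Rmx mxE /=; congr (nat_of_bool _)%:R; lia. Qed.

Lemma tr_Pmx n : (Pmx K n)^T = Pmx K n.
Proof. by apply/matrixP=> i j; rewrite mxE !PmxE addnC. Qed.

Lemma Pmx_unit n : Pmx K n \in unitmx.
Proof.
rewrite unitmx_mul Smx_unit /=.
by have /mulmx1_unit[] := Rmx_involutive n.
Qed.

Lemma antitrK n : involutive (@antitr K n).
Proof.
move=> X; rewrite /antitr !trmx_mul trmxK tr_Rmx -!mulmxA Rmx_involutive mulmx1.
by rewrite mulmxA Rmx_involutive mul1mx.
Qed.

Lemma antitrE n (X : 'M[K]_n) i j : antitr X i j = X (rev_ord j) (rev_ord i).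
Proof. by rewrite mulmx_Rmx mul_Rmx mxE. Qed.

Lemma antitr_strictly_lower n (X : 'M[K]_n) :
  strictly_lower X -> strictly_lower (antitr X).
Proof. by move=> lowX i j leij; rewrite antitrE lowX //=; lia. Qed.

Lemma WmxE N (i : 'I_N.+1) (j : 'I_N) : Wmx K N i j = (i + j == N.-1)%N%:R.
Proof.
rewrite castmxE mxE cast_ord_id.
case: splitP => k /= ek; rewrite !mxE.
  rewrite -val_eqE /= ek; congr (nat_of_bool _)%:R; have := ltn_ord j; lia.
rewrite (_ : (_ == _) = false) //.
have := ltn_ord j; lia.
Qed.

Lemma tr_Wmx_mul N m (X : 'M[K]_(N.+1, m)) i j :
  ((Wmx K N)^T *m X) i j = X (widen_ord (leqnSn N) (rev_ord i)) j.
Proof.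
rewrite mxE (bigD1 (widen_ord (leqnSn N) (rev_ord i))) //= big1 ?addr0.
  rewrite mxE WmxE /= (_ : (_ == _)) ?mul1r //; have := ltn_ord i; lia.
move=> k; rewrite -val_eqE /= => ne_k; rewrite mxE WmxE (_ : (_ == _) = false) ?mul0r //.
have := ltn_ord i; lia.
Qed.

(** W pads with a zero last coordinate, up to reversal: it is an isometry onto
    the orthogonal complement of e_N, and Wmx_tr_Wmx is the projection there. *)
Lemma tr_Wmx_Wmx N : (Wmx K N)^T *m Wmx K N = 1%:M.
Proof.
apply/matrixP=> i j; rewrite tr_Wmx_mul WmxE mxE -val_eqE /=.
congr (nat_of_bool _)%:R; have := ltn_ord i; have := ltn_ord j; lia.
Qed.

Lemma tr_Wmx_last N : (Wmx K N)^T *m unit_col K ord_max = 0.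
Proof.
apply/matrixP=> i j; rewrite tr_Wmx_mul !mxE -val_eqE /= (_ : (_ == _) = false) //.
have := ltn_ord i; lia.
Qed.

Lemma mul_tr_Wmx N m (X : 'M[K]_(m, N)) i (j : 'I_N.+1) (k : 'I_N) :
  (j + k)%N = N.-1 -> (X *m (Wmx K N)^T) i j = X i k.
Proof.
move=> jk; rewrite mxE (bigD1 k) //= big1 ?addr0 => [|l].
  by rewrite mxE WmxE jk eqxx mulr1.
rewrite -val_eqE /= => ne_l; rewrite mxE WmxE (_ : (_ == _) = false) ?mulr0 //.
lia.
Qed.

Lemma mul_tr_Wmx_last N m (X : 'M[K]_(m, N)) i (j : 'I_N.+1) :
  (N <= j)%N -> (X *m (Wmx K N)^T) i j = 0.
Proof.
move=> leNj; rewrite mxE big1 // => l _.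
rewrite mxE WmxE (_ : (_ == _) = false) ?mulr0 //; have := ltn_ord l; lia.
Qed.

Lemma Wmx_tr_Wmx N :
  Wmx K N *m (Wmx K N)^T = 1%:M - unit_col K ord_max *m (unit_col K ord_max)^T.
Proof.
apply/matrixP=> i j; rewrite !mxE big_ord1 !mxE -!val_eqE /= !andbT.
have [ltjN|leNj] := ltnP j N.
  have jN1 : (N.-1 - j < N)%N by lia.
  have jk : (j + Ordinal jN1)%N = N.-1 by rewrite /=; lia.
  have := mul_tr_Wmx (Wmx K N) i jk; rewrite mxE => ->; rewrite WmxE /=.
  rewrite (ltn_eqF ltjN) mulr0 subr0.
  by congr (nat_of_bool _)%:R; lia.
have := mul_tr_Wmx_last (Wmx K N) i leNj; rewrite mxE => ->.
have -> : nat_of_ord j = N by have := ltn_ord j; lia.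
by rewrite eqxx mulr1 subrr.
Qed.

(** Reading P with its rows reversed gives a strict staircase, reading Pbar
    with its columns reversed gives a weak staircase on the other side of the
    diagonal; the two are complementary in the all-ones matrix. *)
Lemma tr_Wmx_Pmx N :
  (Wmx K N)^T *m Pmx K N.+1
    = ones K N *m (ones K N.+1)^T - Pmx K N *m (Wmx K N)^T.
Proof.
apply/matrixP=> i j; rewrite tr_Wmx_mul PmxE; apply/eqP.
rewrite mxE [X in _ + X]mxE [X in X - _]mxE big_ord1 !mxE mulr1 eq_sym subr_eq; apply/eqP.
have := ltn_ord i => ltiN.
have [ltjN|leNj] := ltnP j N.
  have jN1 : (N.-1 - j < N)%N by lia.
  have jk : (j + Ordinal jN1)%N = N.-1 by rewrite /=; lia.
  have := mul_tr_Wmx (Pmx K N) i jk; rewrite mxE => ->; rewrite PmxE /=.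
  have -> : (N.+1 <= (N - i.+1 + j).+1)%N = ~~ (j <= i)%N by lia.
  have -> : (N <= (i + (N.-1 - j)).+1)%N = (j <= i)%N by lia.
  by case: (j <= i)%N; rewrite ?addr0 ?add0r.
have := mul_tr_Wmx_last (Pmx K N) i leNj; rewrite mxE => ->.
by rewrite addr0 (_ : (_ < _)%N) //=; lia.
Qed.

Lemma Pmx_last N : Pmx K N.+1 *m unit_col K ord_max = ones K N.+1.
Proof.
apply/matrixP=> i j; rewrite ord1 -colE mxE PmxE mxE (_ : (_ < _)%N) //.
by rewrite /=; lia.
Qed.

Lemma Pmx_first N : Pmx K N.+1 *m unit_col K ord0 = unit_col K ord_max.
Proof.
apply/matrixP=> i j; rewrite ord1 -colE mxE PmxE mxE eqxx andbT -val_eqE /=.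
congr (nat_of_bool _)%:R; have := ltn_ord i; lia.
Qed.

(** Column 0 of tr_Wmx_Pmx. *)
Lemma Pmx_tr_Wmx_first N : Pmx K N *m (Wmx K N)^T *m unit_col K ord0 = ones K N.
Proof.
have -> : Pmx K N *m (Wmx K N)^T
            = ones K N *m (ones K N.+1)^T - (Wmx K N)^T *m Pmx K N.+1.
  by rewrite tr_Wmx_Pmx opprB addrC subrK.
rewrite mulmxBl -[(Wmx K N)^T *m _ *m _]mulmxA Pmx_first tr_Wmx_last subr0 -mulmxA.
rewrite -colE (_ : col _ _ = 1%:M) ?mulmx1 //.
by apply/matrixP=> i j; rewrite !ord1 !mxE.
Qed.

(** * The resolvent *)

Definition resolvent N (q : K) (Ht : 'M[K]_N.+1) :=
  invmx ((1 + q)%:M + q *: (Smx K N.+1 *m Ht)).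

(** This is what lets the antitranspose of Ht S be read as S Ht^A. *)
Lemma antitr_Smx n : antitr (Smx K n) = Smx K n.
Proof.
apply/matrixP=> i j; rewrite antitrE !mxE; congr (nat_of_bool _)%:R => /=.
have := ltn_ord i; have := ltn_ord j; lia.
Qed.

Lemma invmx_Pmx n : invmx (Pmx K n) = Rmx K n *m invmx (Smx K n).
Proof.
have P1 : Rmx K n *m invmx (Smx K n) *m Pmx K n = 1%:M.
  by rewrite /Pmx mulmxA mulmxKV ?Smx_unit // Rmx_involutive.
by rewrite -[RHS](mulmxK (Pmx_unit n)) P1 mul1mx.
Qed.

Section Resolvent.
Variables (N : nat) (q : K) (Ht : 'M[K]_N.+1).
Hypotheses (q_gt0 : 0 < q) (lowHt : strictly_lower Ht).
Notation S := (Smx K N.+1).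
Notation P := (Pmx K N.+1).
Notation W := (Wmx K N).
Notation e0 := (unit_col K (@ord0 N)).
Notation eN := (unit_col K (@ord_max N)).
Let M := (1 + q)%:M + q *: (S *m Ht).
Let B := resolvent q Ht.

Let q1_neq0 : 1 + q != 0. Proof. by rewrite gt_eqF // ltr_wpDl. Qed.
Let q_neq0 : q != 0. Proof. by rewrite gt_eqF. Qed.

Lemma Smx_strictly_lower : strictly_lower (S *m Ht).
Proof.
move=> i j leij; rewrite mxE big1 // => k _; rewrite mxE.
have [leki|] := leqP k i; last by rewrite mul0r.
by rewrite lowHt ?mulr0 // (leq_trans leki).
Qed.

Lemma resolvent_den_unit : M \in unitmx.
Proof.
rewrite unitmxE det_trig; last first.
  apply/is_trig_mxP=> i j ltij; rewrite !mxE -val_eqE ltn_eqF //=.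
  have := Smx_strictly_lower (ltnW ltij); rewrite mxE => ->.
  by rewrite mulr0 addr0.
rewrite (eq_bigr (fun=> 1 + q)) => [|i _].
  by rewrite prodr_const unitfE expf_neq0.
rewrite !mxE eqxx; have := Smx_strictly_lower (leqnn i); rewrite mxE => ->.
by rewrite mulr0 addr0.
Qed.

(** The factor S^-1 + Ht is, after multiplication by q S, the denominator
    minus I; this turns the product defining S H into an affine function of the
    resolvent. *)
Lemma SHmx_resolvent : SHmx q Ht = q^-1 *: (1%:M - B).
Proof.
apply/(@scalerI _ _ q); rewrite ?scalerA ?divff ?scale1r //.
rewrite /SHmx /Hmx -/(resolvent q Ht) -/B mulmxA mulmxDr mulmxV ?Smx_unit // scalemxAl.
have -> : q *: (1%:M + S *m Ht) = M - 1%:M.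
  by rewrite /M scalerDr scalemx1 raddfD /= addrAC [1%:M + _]addrC addrK.
by rewrite mulmxBl mulmxV ?resolvent_den_unit // mul1mx.
Qed.

(** The last column and the first row of S Ht vanish, which makes e_N a right
    and e_0 a left eigenvector of the resolvent. *)
Lemma resolvent_last : B *m eN = (1 + q)^-1 *: eN.
Proof.
apply: (can_inj (mulKmx resolvent_den_unit)).
rewrite mulmxA mulmxV ?resolvent_den_unit // mul1mx -scalemxAr mulmxDl.
rewrite mul_scalar_mx -scalemxAl -[S *m _ *m _]mulmxA (_ : Ht *m eN = 0).
  by rewrite mulmx0 scaler0 addr0 scalerA mulVf // scale1r.
apply/matrixP=> i j; rewrite ord1 -colE !mxE lowHt //=.
by rewrite -ltnS ltn_ord.
Qed.

Lemma resolvent_first : e0^T *m B = (1 + q)^-1 *: e0^T.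
Proof.
apply: (can_inj (mulmxK resolvent_den_unit)).
rewrite -mulmxA mulVmx ?resolvent_den_unit // mulmx1 -scalemxAl mulmxDr.
rewrite mul_mx_scalar -scalemxAr mulmxA (_ : e0^T *m S *m Ht = 0).
  by rewrite scaler0 addr0 scalerA mulVf // scale1r.
have -> : e0^T *m S = e0^T.
  rewrite trmx_delta -rowE; apply/matrixP=> i j; rewrite ord1 !mxE leqn0 eqxx /=.
  by rewrite -val_eqE.
by rewrite trmx_delta -rowE; apply/matrixP=> i j; rewrite !mxE lowHt.
Qed.

(** With M the matrix inverted in the resolvent, S Ht^A = (Ht S)^A and Ht S is
    conjugate to S Ht through S, so the antitranspose of Ht produces
    S M^A S^-1 = P M^T P^-1. *)
Lemma resolvent_antitr : resolvent q (antitr Ht) = P *m B^T *m invmx P.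
Proof.
have den : (1 + q)%:M + q *: (S *m antitr Ht) = P *m M^T *m invmx P.
  rewrite /M linearD /= tr_scalar_mx linearZ /= mulmxDr mulmxDl mul_mx_scalar.
  rewrite -scalemxAl mulmxV ?Pmx_unit // scalemx1 -scalemxAr -scalemxAl.
  congr (_ + _ *: _).
  have trS_R : S^T *m Rmx K N.+1 = Rmx K N.+1 *m S.
    by rewrite -{2}[S]antitr_Smx /antitr -mulmxA mulmxA Rmx_involutive mul1mx.
  rewrite trmx_mul invmx_Pmx mulmxA -[X in X *m invmx _]mulmxA -[X in X *m invmx _]mulmxA.
  by rewrite -[Ht^T *m _ *m _]mulmxA trS_R /Pmx /antitr !mulmxA mulmxK ?Smx_unit.
have uM : M^T \in unitmx by rewrite unitmx_tr resolvent_den_unit.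
have uPV : invmx P \in unitmx by rewrite unitmx_inv Pmx_unit.
have uPM : P *m M^T \in unitmx by rewrite unitmx_mul Pmx_unit.
have uD : P *m M^T *m invmx P \in unitmx by rewrite unitmx_mul uPM.
rewrite /resolvent den; apply: (can_inj (mulmxK uD)).
rewrite mulVmx // -[P *m M^T *m _]mulmxA [RHS]mulmxA mulmxKV ?Pmx_unit //.
rewrite -mulmxA (mulmxA B^T) /B /resolvent -/M trmx_inv mulVmx // mul1mx.
by rewrite mulmxV ?Pmx_unit.
Qed.

Lemma vH_resolvent : vH q Ht = B *m ones K N.+1.
Proof.
by rewrite /vH SHmx_resolvent scalerA divff // scale1r opprB addrCA subrr addr0.
Qed.

Lemma slackA_resolvent :
  slackA q Ht = q^-1 *: (1%:M - B + B *m ones K N.+1 *m e0^T).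
Proof. by rewrite /slackA SHmx_resolvent vH_resolvent -scalerDr. Qed.

Lemma slackw_resolvent :
  slackw q Ht
    = ((1 + q) / q) *: (B^T *m eN - etaH q Ht *: e0) - q^-1 *: eN.
Proof.
rewrite /slackw SHmx_resolvent scalerA linearB /= linearZ /= linearB /= trmx1.
rewrite mulmxBl -scalemxAl mulmxBl !mul1mx scalerBr [in RHS]scalerBr scalerA.
set t := _ *: e0; set u := _ *: (B^T *m eN).
have -> : eN - ((1 + q) / q *: eN - u) - t = u - t + (eN - (1 + q) / q *: eN).
  by rewrite opprB addrCA addrAC.
congr (_ + _); rewrite -{1}[eN]scale1r -scalerBl -scaleNr; congr (_ *: _).
by field.
Qed.

Lemma etaH_resolvent : etaH q Ht = (eN^T *m B *m ones K N.+1) 0 0.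
Proof. by rewrite /etaH vH_resolvent mulmxA. Qed.

End Resolvent.

(** * Slack data of the reversed algorithm *)

Section Duality.
Variables (N : nat) (q : K) (Ht : 'M[K]_N.+1).
Hypotheses (q_gt0 : 0 < q) (lowHt : strictly_lower Ht).
Notation P := (Pmx K N.+1).
Notation W := (Wmx K N).
Notation Pb := (Pmx K N).
Notation e0 := (unit_col K (@ord0 N)).
Notation eN := (unit_col K (@ord_max N)).
Notation ones1 := (ones K N.+1).
Let B := resolvent q Ht.
Let lowHt' := antitr_strictly_lower lowHt.

Let q1_neq0 : 1 + q != 0. Proof. by rewrite gt_eqF // ltr_wpDl. Qed.
Let q_neq0 : q != 0. Proof. by rewrite gt_eqF. Qed.

Lemma invPmx_ones : invmx P *m ones1 = eN.
Proof. by rewrite -Pmx_last mulKmx ?Pmx_unit. Qed.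

Lemma last_invPmx : eN^T *m invmx P = e0^T.
Proof.
by rewrite -Pmx_first trmx_mul tr_Pmx mulmxK ?Pmx_unit.
Qed.

Lemma vH_antitr : vH q (antitr Ht) = P *m B^T *m eN.
Proof.
by rewrite vH_resolvent // resolvent_antitr // -(mulmxA _ (invmx P)) invPmx_ones.
Qed.

Lemma etaH_antitr : etaH q (antitr Ht) = etaH q Ht.
Proof.
have last_P : eN^T *m P = ones1^T by rewrite -Pmx_last trmx_mul tr_Pmx.
rewrite /etaH vH_antitr (mulmxA eN^T (P *m B^T)) (mulmxA eN^T P) last_P.
by rewrite vH_resolvent // -[_ *m eN]tr_mx11 !trmx_mul !trmxK.
Qed.

(** The transpose of tr_Wmx_Pmx, solved for P^-1. *)
Lemma invPmx_Wmx : invmx P *m (W *m Pb) = eN *m (ones K N)^T - W.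
Proof.
apply: (canLR (mulKmx (Pmx_unit N.+1))).
have := congr1 trmx (tr_Wmx_Pmx N).
rewrite linearB /= (trmx_mul _ P) (trmx_mul (ones K N)) (trmx_mul Pb).
rewrite !trmxK !tr_Pmx => PW.
by rewrite mulmxBr (mulmxA P) Pmx_last PW opprB addrC subrK.
Qed.

(** Since v' = P B^T e_N and e_0^T = e_N^T P^-1, the rank-one term of A' turns
    the identity in P B^T P^-1 into the projection W W^T, which kills the e_N
    produced by invPmx_Wmx. The leftover 1 1^T of tr_Wmx_Pmx becomes the
    rank-one term of A^T. *)
Lemma slackA_antitr :
  W^T *m slackA q (antitr Ht) *m (W *m Pb) = Pb *m W^T *m (slackA q Ht)^T *m W.
Proof.
rewrite {1}/slackA SHmx_resolvent // vH_antitr resolvent_antitr // -scalerDr.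
rewrite slackA_resolvent // -/B.
have := Pmx_tr_Wmx_first N; have := tr_Wmx_Pmx N; have := invPmx_Wmx.
have := last_invPmx.
(* Only these identities matter from here on, not the entries of P and Pbar. *)
move: P Pb (invmx P) => P' Pb' iP eiP iPW WP PbW0.
have -> : 1%:M - P' *m B^T *m iP + P' *m B^T *m eN *m e0^T
            = 1%:M - P' *m B^T *m (W *m W^T) *m iP.
  rewrite Wmx_tr_Wmx mulmxBr mulmx1 mulmxBl opprB addrAC addrA.
  by rewrite -eiP !mulmxA.
have WWiP : W *m W^T *m (iP *m (W *m Pb')) = - W.
  rewrite iPW mulmxBr mulmxA -[W *m W^T *m eN]mulmxA tr_Wmx_last mulmx0 mul0mx.
  by rewrite -mulmxA tr_Wmx_Wmx mulmx1 sub0r.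
rewrite -scalemxAr -scalemxAl linearZ /= -scalemxAr -scalemxAl; congr (_ *: _).
rewrite -(mulmxA W^T) mulmxBl mul1mx -(mulmxA _ iP) -(mulmxA _ (W *m W^T)) WWiP.
rewrite mulmxN opprK mulmxDr mulmxA tr_Wmx_Wmx mul1mx !mulmxA WP.
rewrite linearD linearB /= trmx1 !trmx_mul trmxK mulmxDr mulmxBr mulmx1 mulmxDl.
rewrite !mulmxA PbW0 -[_ - _ + _]addrA [RHS]mulmxDl -[Pb' *m W^T *m W]mulmxA.
by rewrite tr_Wmx_Wmx mulmx1; congr (_ + _ *m _); rewrite mulNmx addrC.
Qed.

(** Up to the factor (1 + q) / q, b' is P B^T e_N; applying tr_Wmx_Pmx gives
    eta 1 - Pbar W^T B^T e_N, and eta 1 is the image under Pbar W^T of the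
    eta e_0 in w. The remaining e_N in w is killed by W^T. *)
Lemma slackb_antitr : W^T *m slackb q (antitr Ht) = - (Pb *m (W^T *m slackw q Ht)).
Proof.
have := Pmx_tr_Wmx_first N; have := tr_Wmx_Pmx N.
rewrite /slackb vH_antitr slackw_resolvent // -/B.
have : (etaH q Ht)%:M = ones1^T *m B^T *m eN.
  apply/matrixP=> i j; rewrite !ord1 etaH_resolvent // mxE eqxx mulr1n.
  by rewrite -[_ *m ones1]tr_mx11 !trmx_mul trmxK mulmxA.
move: P Pb (etaH q Ht) => P' Pb' eta etaE WP PbW0.
rewrite mulmxA -scalemxAr mulmxBr -!scalemxAr -[Pb' *m W^T *m eN]mulmxA tr_Wmx_last mulmx0.
rewrite scaler0 subr0 -scalerN; congr (_ *: _).
rewrite mulmxBr -scalemxAr PbW0 opprB -mul_mx_scalar etaE !mulmxA WP.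
by rewrite !mulmxBl.
Qed.

Lemma slackzeta_antitr : slackzeta q (antitr Ht) = slackzeta q Ht.
Proof. by rewrite /slackzeta etaH_antitr. Qed.

Hypothesis N_gt0 : (0 < N)%N.

Lemma tr_first_last : e0^T *m eN = 0.
Proof.
apply/matrixP=> i j; rewrite !ord1 trmx_delta -rowE !mxE -val_eqE /=.
by rewrite eq_sym (gtn_eqF N_gt0).
Qed.

(** The coefficient 1 / q of e_N in w cancels (1 + q) / q times the last entry
    1 / (1 + q) of B^T e_N; the term along e_0 is orthogonal to e_N as N > 0. *)
Lemma slackw_last : W *m (W^T *m slackw q Ht) = slackw q Ht.
Proof.
have Bl : eN^T *m (B^T *m eN) = (1 + q)^-1 *: (eN^T *m eN).
  rewrite -[LHS]tr_mx11 !trmx_mul !trmxK -mulmxA resolvent_last //.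
  by rewrite -scalemxAr.
have l0 : eN^T *m e0 = 0 by rewrite -[LHS]tr_mx11 trmx_mul trmxK tr_first_last.
have last_w : eN^T *m slackw q Ht = 0.
  rewrite slackw_resolvent // mulmxBr -!scalemxAr mulmxBr -!scalemxAr Bl l0.
  rewrite scaler0 subr0 scalerA -scalerBl (_ : _ - _ = 0) ?scale0r //.
  by field; apply/andP.
by rewrite mulmxA Wmx_tr_Wmx mulmxBl mul1mx -mulmxA last_w mulmx0 subr0.
Qed.

(** A maps e_N to a multiple of itself, so W^T A e_N = 0. *)
Lemma slackA_last : W *m W^T *m (slackA q Ht)^T *m W = (slackA q Ht)^T *m W.
Proof.
have last_AW : eN^T *m (slackA q Ht)^T *m W = 0.
  apply: trmx_inj; rewrite trmx0 !trmx_mul !trmxK slackA_resolvent // -scalemxAl.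
  rewrite mulmxDl mulmxBl mul1mx resolvent_last //.
  rewrite -[_ *m e0^T *m eN]mulmxA tr_first_last mulmx0.
  rewrite addr0 -scalemxAr mulmxBr tr_Wmx_last -scalemxAr tr_Wmx_last.
  by rewrite !scaler0 subr0 scaler0.
rewrite Wmx_tr_Wmx mulmxBl mul1mx mulmxBl -(mulmxA eN) -(mulmxA eN) last_AW.
by rewrite mulmx0 subr0.
Qed.

End Duality.

(** * Congruence of the slack matrices *)

Lemma liftW_symmetric N (G : 'M[K]_N) : symmetric_mx (liftW G) <-> symmetric_mx G.
Proof.
rewrite /symmetric_mx /liftW; split=> [symWG|symG].
  have GE (X : 'M[K]_N) : X = (Wmx K N)^T *m (Wmx K N *m X *m (Wmx K N)^T) *m Wmx K N.
    by rewrite !mulmxA tr_Wmx_Wmx mul1mx -mulmxA tr_Wmx_Wmx mulmx1.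
  rewrite (GE G^T) [RHS]GE -[in RHS]symWG !trmx_mul trmxK.
  by rewrite !mulmxA.
by rewrite !trmx_mul trmxK symG mulmxA.
Qed.

Lemma sym_congruence n (C X : 'M[K]_n) : C *m sym X *m C^T = sym (C *m X *m C^T).
Proof.
rewrite /sym -scalemxAr -scalemxAl mulmxDr mulmxDl; congr (_ *: (_ + _)).
by rewrite !trmx_mul trmxK mulmxA.
Qed.

Lemma sym_tr n (X : 'M[K]_n) : sym X^T = sym X.
Proof. by rewrite /sym trmxK addrC. Qed.

Lemma sandwich_inv_cancel n (P L : 'M[K]_n) :
    P \in unitmx -> L \in unitmx ->
  L *m (P *m (invmx (P *m L *m P) *m P)) = 1%:M.
Proof.
move=> uP uL; have uPLP : P *m L *m P \in unitmx by rewrite !unitmx_mul uP uL.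
apply: (can_inj (mulKmx uP)).
by rewrite mulmx1 !mulmxA mulmxV // mul1mx.
Qed.

Lemma sandwich_invK n (P L : 'M[K]_n) :
    P \in unitmx -> L \in unitmx ->
  invmx (P *m invmx (P *m L *m P) *m P) = L.
Proof.
move=> uP uL; have := sandwich_inv_cancel uP uL; rewrite (mulmxA P) => LX1.
have [_ uX] := mulmx1_unit LX1.
by rewrite -[LHS]mul1mx -LX1 mulmxK.
Qed.

Lemma sandwich_inv_symmetric n (P L : 'M[K]_n) :
  P^T = P -> symmetric_mx L -> symmetric_mx (invmx (P *m L *m P)).
Proof.
move=> symP symL; rewrite /symmetric_mx trmx_inv; congr invmx.
by rewrite !trmx_mul symP symL mulmxA.
Qed.

Section Congruence.
Variables (N : nat) (q tau : K) (Ht : 'M[K]_N.+1) (Lambda : 'M[K]_N).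
Hypotheses (N_gt0 : (0 < N)%N) (q_gt0 : 0 < q) (lowHt : strictly_lower Ht).
Hypothesis Lambda_unit : Lambda \in unitmx.
Notation W := (Wmx K N).
Notation Pb := (Pmx K N).
Let Phi := invmx (Pb *m Lambda *m Pb).

Lemma lifted_slack_congruence :
  lifted_slack q tau (liftW Lambda) Ht
    = reversal_congruence Lambda *m lifted_slack q tau (liftW Phi) (antitr Ht)
        *m (reversal_congruence Lambda)^T.
Proof.
have := sandwich_inv_cancel (Pmx_unit N) Lambda_unit; rewrite -/Phi => PhiK.
have A_last := slackA_last q_gt0 lowHt N_gt0.
have A_dual := slackA_antitr q_gt0 lowHt.
have b_dual := slackb_antitr q_gt0 lowHt.
have w_last := slackw_last q_gt0 lowHt N_gt0.
(* b_dual for the reversed algorithm, whose reversal is the original one. *)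
have w_dual := slackb_antitr q_gt0 (antitr_strictly_lower lowHt).
rewrite antitrK in w_dual.
have trPb := tr_Pmx N.
rewrite /lifted_slack /reversal_congruence slackzeta_antitr // /liftW.
move: Pb Phi PhiK A_dual b_dual w_dual trPb => Pb' Phi' PhiK A_dual b_dual w_dual trPb.
set C := W *m Lambda *m W^T *m (W *m Pb' *m W^T).
have CE : C = W *m Lambda *m Pb' *m W^T.
  rewrite /C -!(mulmxA W Lambda) -(mulmxA W) -!mulmxA; do 2!congr (_ *m _).
  by rewrite !mulmxA tr_Wmx_Wmx mul1mx.
rewrite tr_block_mx !trmx0 mulmx_block !mul0mx !addr0 !add0r.
rewrite mulmx_block !mulmx0 !addr0 !add0r.
have CV : C^T = W *m Pb' *m Lambda^T *m W^T.
  by rewrite CE !trmx_mul trmxK trPb !mulmxA.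
have CPhi : C *m (W *m Phi' *m W^T) = W *m (Lambda *m (Pb' *m Phi')) *m W^T.
  by rewrite CE -!mulmxA (mulmxA W^T W) tr_Wmx_Wmx mul1mx.
have dualA : C *m (W *m Phi' *m W^T *m slackA q (antitr Ht)) *m C^T
    = (W *m Lambda *m W^T *m slackA q Ht)^T.
  rewrite mulmxA CPhi CV -[_ *m W^T *m _]mulmxA -[W *m Pb' *m _ *m _]mulmxA.
  rewrite mulmxA -[_ *m (W^T *m _) *m _]mulmxA A_dual.
  rewrite -!mulmxA (mulmxA Phi') (mulmxA Pb' (Phi' *m _)) (mulmxA Lambda (Pb' *m _)).
  by rewrite PhiK mul1mx !trmx_mul trmxK !mulmxA A_last.
have dualb : C *m (W *m Phi' *m W^T *m slackb q (antitr Ht)) = - slackw q Ht.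
  rewrite mulmxA CPhi -mulmxA b_dual mulmxN; congr (- _).
  rewrite -!mulmxA (mulmxA Phi' Pb') (mulmxA Pb' (Phi' *m _)).
  by rewrite (mulmxA Lambda (Pb' *m _)) PhiK mul1mx w_last.
have dualw : C *m slackw q (antitr Ht) = - (W *m Lambda *m W^T *m slackb q Ht).
  by rewrite -[in RHS]mulmxA w_dual mulmxN opprK CE !mulmxA.
congr block_mx.
- rewrite -scalemxAr -scalemxAl; congr (_ *: _).
  rewrite sym_congruence (linearN trmx) /= mulmxN !mulNmx opprK dualA.
  by rewrite sym_tr.
- rewrite tr_block_mx !trmx0 !trmx1 mulNmx mul_mx_row dualb dualw.
  by rewrite -opp_row_mx opprK mul_row_block !mulmx0 !mulmx1 add0r addr0.
- rewrite mul_block_col !mul0mx !mul1mx add0r addr0 mul_col_mx -2!trmx_mul.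
  by rewrite !mulNmx dualb dualw !opprK.
- rewrite tr_block_mx !trmx0 !trmx1 !mulmx_block !mulmx0 !mul0mx !mul1mx !mulmx1.
  by rewrite !add0r !addr0.
Qed.

End Congruence.

(** * The slack matrix as a quadratic form *)

Lemma row_unit_col n d i (X : 'M[K]_(n, d)) : row i X = (unit_col K i)^T *m X.
Proof. by rewrite trmx_delta rowE. Qed.

Lemma sqnormE d (x : 'rV[K]_d) : sqnorm x = \tr (x^T *m x).
Proof. by apply: eq_bigr => j _; rewrite mxE big_ord1 mxE expr2. Qed.

Lemma sqnorm_ge0 d (x : 'rV[K]_d) : 0 <= sqnorm x.
Proof. by apply: sumr_ge0 => j _; rewrite sqr_ge0. Qed.

Lemma sqnormD d (x y : 'rV[K]_d) (a : K) :
  sqnorm (x + a *: y) = sqnorm x + 2 * a * \tr (x^T *m y) + a ^+ 2 * sqnorm y.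
Proof.
rewrite !sqnormE [(_ + _)^T]linearD /= linearZ /= mulmxDr !mulmxDl -!scalemxAl -!scalemxAr.
rewrite !mxtraceD !mxtraceZ -(mxtrace_tr (y^T *m x)) trmx_mul trmxK; ring.
Qed.

Section Form.
Variables (N d : nat) (q tau : K) (G Ht : 'M[K]_N.+1).
Notation A := (slackA q Ht).
Notation b := (slackb q Ht).
Notation w := (slackw q Ht).
Notation zeta := (slackzeta q Ht).

Lemma lifted_slack_form (g : 'M[K]_(N.+1, d)) (s u : 'rV[K]_d) :
  let z := col_mx g (col_mx s u) in
  \tr (z^T *m lifted_slack q tau G Ht *m z)
    = tau * sqnorm s + tau * sqnorm u
      + 2 * \tr (u^T *m (w^T *m g + zeta *: s))
      + 2 * \tr (g^T *m G *m (b *m s - A *m g)).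
Proof.
move=> z; rewrite /z /lifted_slack; move: A b w zeta => A' b' w' zeta'.
rewrite -mulmxA mul_block_col mul_row_col mul_col_mx.
rewrite mul_block_col add_col_mx !tr_col_mx !mul_row_col !mul_scalar_mx.
rewrite !mulmxDr !mxtraceD -!scalemxAr !mxtraceZ -scalemxAl -scalemxAr mxtraceZ.
have -> : \tr (g^T *m (sym (G *m A') *m g)) = \tr (g^T *m G *m (A' *m g)).
  rewrite /sym -scalemxAl -scalemxAr mxtraceZ mulmxDl mulmxDr mxtraceD.
  rewrite -(mxtrace_tr (_ *m (_^T *m g))) !trmx_mul !trmxK !mulmxA.
  by field.
have -> : \tr (s^T *m ((G *m b')^T *m g)) = \tr (g^T *m G *m (b' *m s)).
  by rewrite -mxtrace_tr !trmx_mul !trmxK !mulmxA.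
have -> : \tr (g^T *m (w' *m u)) = \tr (u^T *m (w'^T *m g)).
  by rewrite -mxtrace_tr !trmx_mul !trmxK !mulmxA.
have -> : \tr (s^T *m u) = \tr (u^T *m s).
  by rewrite -mxtrace_tr !trmx_mul !trmxK.
have -> : \tr (g^T *m (G *m b' *m s)) = \tr (g^T *m G *m (b' *m s)).
  by rewrite !mulmxA.
rewrite mulmxN raddfN /= !sqnormE; ring.
Qed.

(** Completing the square in u: for tau > 0 the minimum over u is twice the
    certificate expression, attained at u = - y / tau. *)
Lemma lifted_slack_square (g : 'M[K]_(N.+1, d)) (s u : 'rV[K]_d) :
    tau != 0 ->
  let z := col_mx g (col_mx s u) in
  let y := w^T *m g + zeta *: s in
  \tr (z^T *m lifted_slack q tau G Ht *m z)
    = 2 * (tau / 2 * sqnorm s - (2 * tau)^-1 * sqnorm y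
           + \tr (g^T *m G *m (b *m s - A *m g)))
      + tau * sqnorm (u + tau^-1 *: y).
Proof.
move=> tau_neq0 z y; rewrite lifted_slack_form -/y (sqnormD u).
by field.
Qed.

End Form.

Section Trajectory.
Variables (N d : nat) (q : K) (Ht : 'M[K]_N.+1).
Hypotheses (q_gt0 : 0 < q) (lowHt : strictly_lower Ht).
Variables (y0 : 'rV[K]_d) (g : 'M[K]_(N.+1, d)).
Notation e0 := (unit_col K (@ord0 N)).
Notation eN := (unit_col K (@ord_max N)).
Notation s0 := (row ord0 (traj_s q Ht y0 g)).

Let q1_neq0 : 1 + q != 0. Proof. by rewrite gt_eqF // ltr_wpDl. Qed.
Let q_neq0 : q != 0. Proof. by rewrite gt_eqF. Qed.

(** The map from y_0 to s_0 is a bijection for fixed g, so s_0 may serve as the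
    free variable. *)
Lemma traj_s_first : s0 = (1 + q)^-1 *: (row ord0 g + q *: y0).
Proof.
rewrite !row_unit_col /traj_s mulmxDr -scalemxAr.
have ones_first : e0^T *m ones K N.+1 = 1%:M.
  by rewrite trmx_delta -rowE; apply/matrixP=> i j; rewrite !mxE !ord1.
have x_first : e0^T *m traj_x q Ht y0 g = (1 + q)^-1 *: (y0 - e0^T *m g).
  rewrite /traj_x SHmx_resolvent // vH_resolvent // mulmxDr mulmxN -scalemxAl.
  rewrite -scalemxAr !mulmxA mulmxBr mulmx1 resolvent_first // -!scalemxAl ones_first.
  rewrite mul1mx mulmxBl -scalemxAl; move: (e0^T *m g) => g0.
  by apply/matrixP=> i j; rewrite !mxE; field; apply/andP.
rewrite x_first; move: (e0^T *m g) => g0.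
by apply/matrixP=> i j; rewrite !mxE; field.
Qed.

Lemma traj_x_slack : traj_x q Ht y0 g = slackb q Ht *m s0 - slackA q Ht *m g.
Proof.
rewrite traj_s_first row_unit_col /traj_x /slackb /slackA.
rewrite mulmxDl -2!scalemxAl -[vH _ _ *m _ *m g]mulmxA -[vH _ _ *m (_^-1 *: _)]scalemxAr.
rewrite mulmxDr -[vH _ _ *m (q *: _)]scalemxAr.
move: (SHmx q Ht *m g) (vH q Ht *m (_ *m g)) (vH q Ht *m y0) => SHg vg vy.
apply/matrixP=> i j; rewrite !mxE.
by field; apply/andP.
Qed.

Lemma traj_y_last :
  row ord_max (traj_y q Ht y0 g) = (slackw q Ht)^T *m g + slackzeta q Ht *: s0.
Proof.
have yE : traj_y q Ht y0 g = (1 + q) *: traj_x q Ht y0 g + g.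
  by rewrite /traj_y /traj_s scalerDl scale1r addrA addrAC.
have etaE : eN^T *m vH q Ht = (etaH q Ht)%:M by exact: mx11_scalar.
rewrite yE row_unit_col traj_x_slack mulmxDr -scalemxAr mulmxBr.
move: s0 => s.
have -> : eN^T *m (slackb q Ht *m s) = ((1 + q) / q * etaH q Ht) *: s.
  by rewrite mulmxA /slackb -scalemxAr etaE -scalemxAl mul_scalar_mx scalerA.
have -> : eN^T *m (slackA q Ht *m g)
    = eN^T *m SHmx q Ht *m g + (q^-1 * etaH q Ht) *: (e0^T *m g).
  rewrite mulmxA /slackA mulmxDr mulmxDl; congr (_ + _).
  by rewrite -scalemxAr -scalemxAl mulmxA etaE -mulmxA mul_scalar_mx scalerA.
have -> : (slackw q Ht)^T *m g
    = eN^T *m g - (1 + q) *: (eN^T *m SHmx q Ht *m g)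
      - ((1 + q) / q * etaH q Ht) *: (e0^T *m g).
  rewrite /slackw linearB /= trmx_mul trmxK [(_ *: e0)^T]linearZ /=.
  by rewrite mulmxBl mulmxBr mulmx1 mulmxBl -scalemxAr -!scalemxAl.
rewrite /slackzeta.
move: (eN^T *m g) (eN^T *m _ *m g) (e0^T *m g) => gN SHg g0.
by apply/matrixP=> i j; rewrite !mxE; field.
Qed.

End Trajectory.

(** Positive semidefiniteness of the symmetric part of L, tested on d vectors at
    once (and trivial for d = 0), to match certificates over row vectors of a
    given dimension. *)
Definition nonneg_form n d (L : 'M[K]_n) : Prop :=
  forall z : 'M[K]_(n, d), 0 <= \tr (z^T *m L *m z).

Lemma certificate_nonneg_form N d st (q tau : K) (G Ht : 'M[K]_N.+1) :
    0 < q -> 0 < tau -> strictly_lower Ht ->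
  unsigned_certificate d st q tau G Ht <->
    (st = Operator_setting -> symmetric_mx G)
      /\ nonneg_form d (lifted_slack q tau G Ht).
Proof.
move=> q_gt0 tau_gt0 lowHt.
have q_neq0 : q != 0 by rewrite gt_eqF.
have q1_neq0 : 1 + q != 0 by rewrite gt_eqF // ltr_wpDl // ltW.
have tau_neq0 : tau != 0 by rewrite gt_eqF.
split=> -[symG pos]; split=> //.
  move=> z; rewrite -[z]vsubmxK -[dsubmx z]vsubmxK.
  move: (usubmx z) (usubmx (dsubmx z)) (dsubmx (dsubmx z)) => g s u.
  (* The y_0 for which s_0 equals s. *)
  have := pos (q^-1 *: ((1 + q) *: s - row ord0 g)) g.
  set y0 := _ *: (_ - _).
  have sE : row ord0 (traj_s q Ht y0 g) = s.
    rewrite traj_s_first // /y0 scalerA divff // scale1r addrCA subrr addr0.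
    by rewrite scalerA mulVf // scale1r.
  rewrite traj_y_last // traj_x_slack // sE lifted_slack_square // => cert.
  by rewrite addr_ge0 // mulr_ge0 ?sqnorm_ge0 // ltW.
move=> y0 g; rewrite traj_y_last // traj_x_slack //.
set s := row ord0 _; set y := _ + _ *: s.
have := pos (col_mx g (col_mx s (- (tau^-1 *: y)))).
rewrite lifted_slack_square // -/y addNr.
by rewrite (_ : sqnorm 0 = 0) ?mulr0 ?addr0 ?pmulr_rge0 // sqnormE trmx0 mul0mx mxtrace0.
Qed.

Lemma nonneg_form_congruence n d (C L : 'M[K]_n) :
  nonneg_form d L -> nonneg_form d (C *m L *m C^T).
Proof.
by move=> posL z; have := posL (C^T *m z); rewrite trmx_mul trmxK !mulmxA.
Qed.

(** * Transfer of certificates *)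

(** Symmetry of Lambda comes from that of Phi because Lambda is recovered from
    Phi by the same formula. *)
Lemma certificate_of_antitr N d st (q tau : K) (Ht : 'M[K]_N.+1) (L : 'M[K]_N) :
    (0 < N)%N -> 0 < q -> 0 < tau -> strictly_lower Ht -> L \in unitmx ->
  unsigned_certificate d st q tau
    (liftW (invmx (Pmx K N *m L *m Pmx K N))) (antitr Ht) ->
  unsigned_certificate d st q tau (liftW L) Ht.
Proof.
move=> N_gt0 q_gt0 tau_gt0 lowHt uL.
have [to_form _] := certificate_nonneg_form d st
  (liftW (invmx (Pmx K N *m L *m Pmx K N))) q_gt0 tau_gt0
  (antitr_strictly_lower lowHt).
have [_ of_form] := certificate_nonneg_form d st (liftW L) q_gt0 tau_gt0 lowHt.
move=> /to_form[symPhi posPhi]; apply: of_form; split.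
  move=> /symPhi/liftW_symmetric symPhi'; apply/liftW_symmetric.
  rewrite -(sandwich_invK (Pmx_unit N) uL).
  exact: sandwich_inv_symmetric (tr_Pmx N) symPhi'.
rewrite (lifted_slack_congruence tau N_gt0 q_gt0 lowHt uL).
exact: nonneg_form_congruence.
Qed.

End Structured.

Theorem theorem4 (K : realType) (N : nat) (hN : (1 <= N)%N) (q tau : K)
    (hq : 0 < q) (htau : 0 < tau)
    (Ht : 'M[K]_N.+1) (hHt : strictly_lower Ht)
    (Lambda : 'M[K]_N) (hLambda : Lambda \in unitmx) :
  let Phi := invmx (Pmx K N *m Lambda *m Pmx K N) in
  let Rc := reversal_congruence Lambda in
  [/\ lifted_slack q tau (liftW Lambda) Ht
        = Rc *m lifted_slack q tau (liftW Phi) (antitr Ht) *m Rc^T,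
      forall (d : nat) (st : setting),
        unsigned_certificate d st q tau (liftW Lambda) Ht <->
        unsigned_certificate d st q tau (liftW Phi) (antitr Ht)
    & symmetric_mx Lambda -> symmetric_mx Phi].
Proof.
move=> Phi Rc; split; first exact: lifted_slack_congruence.
- have uPhi : Phi \in unitmx.
    by rewrite unitmx_inv unitmx_mul Pmx_unit andbT unitmx_mul Pmx_unit.
  have lowHtA := antitr_strictly_lower hHt.
  move=> d st; split; last first.
    exact: (@certificate_of_antitr K N d st q tau Ht Lambda hN hq htau hHt hLambda).
  have := @certificate_of_antitr K N d st q tau (antitr Ht) Phi hN hq htau lowHtA uPhi.
  by rewrite antitrK sandwich_invK ?Pmx_unit.
- exact: sandwich_inv_symmetric (tr_Pmx K N).
Qed.
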